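(* For every $\beta\in[-1,1]$ and every sequence of integers $(j_n)_{n\ge1}$ with $j_n/n\to\beta$, the limit $$I(\beta)=\lim_{n\to\infty}\frac1n\log N_{j_n}(n)$$ exists, is even and concave (as a function of $\beta\in[-1,1]$), and equals $$I(\beta)=\begin{cases}(1+|\beta|)\log\rho, & |\beta|\le\beta^{*},\\[2pt] |\beta|\,h\!\left(\dfrac{1-|\beta|}{|\beta|}\right), & \beta^{*}\le|\beta|\le1.\end{cases}$$ The same formula holds for the sphere-fiber counts $N_j(n)-N_j(n-1)$.
   Context: Let $F$ be a finite group with identity $e$ and $|F|=r+1\ge2$. Let $L_F=F\wr\mathbb{Z}$ be the group of pairs $x=(\eta,j)$ with $\eta:\mathbb{Z}\to F$ finitely supported (i.e. $\eta(i)=e$ for all but finitely many $i$) and $j\in\mathbb{Z}$, with multiplication $(\eta,j)(\eta',j')=(\eta\cdot\tau_j\eta',\,j+j')$, where $\tau_j\eta'(i)=\eta'(i-j)$ and the product of configurations is pointwise in $F$. The standard generating set is $S=\{t^{\pm1}\}\cup(F\setminus\{e\})$, where $t=(\mathbf{e},1)$ with $\mathbf e$ the trivial configuration, and $c\in F\setminus\{e\}$ is identified with $(\delta^c,0)$, $\delta^c$ being equal to $c$ at $0$ and trivial elsewhere. Let $|x|$ be the word length of $x$ with respect to $S$, and let $\pi:L_F\to\mathbb{Z}$, $\pi(\eta,j)=j$, be the cursor homomorphism. For $j\in\mathbb{Z}$ and $n\ge0$ put $N_j(n)=\#\{x\in L_F:\ |x|\le n,\ \pi(x)=j\}$. (One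 has $N_j(n)=0$ for $|j|>n$.) Set $h(u)=-u\log u-(1-u)\log(1-u)+u\log r$ for $u\in[0,1]$ (natural logarithms, $h(0)=0$, $h(1)=\log r$). Let $\rho=\rho_r>1$ be the unique real number $>1$ with $\rho^3=\rho+r$, let $u_r=r/(r+\rho)\in(0,1)$, and let $\beta^{*}=\frac1{1+u_r}=\frac{\rho^3}{\rho^3+r}$.
   Formalization: Concavity is stated on [0,1] and on [-1,0] only, since on [-1,1] it fails: I(0)=log ρ is less than I(±β* )=(1+β* )log ρ. For |β|=1 one assumes |j_n|≤n eventually, since otherwise N_{j_n}(n)=0 infinitely often and log N is undefined. *)

(* Defs.v *)
From HB Require Import structures.
From mathcomp Require Import all_boot all_order all_fingroup all_algebra.
From mathcomp Require Import finmap.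
From mathcomp Require Import all_classical all_reals all_analysis.
From mathcomp Require Import ring lra.

Set Implicit Arguments.
Unset Strict Implicit.
Unset Printing Implicit Defensive.

Import Order.TTheory GRing.Theory Num.Theory.
Import numFieldNormedType.Exports.

Local Open Scope classical_set_scope.
Local Open Scope ring_scope.

Section WordLength.
Local Open Scope group_scope.
Variables (G : groupType) (S : set G).

Definition is_word (n : nat) (x : G) : Prop :=
  exists s : seq G, [/\ size s = n, (forall g, g \in s -> S g)
                      & \prod_(g <- s) g = x].

Definition generates : Prop := forall x, exists n, is_word n x.

Lemma is_word1 : is_word 0 1.
Proof. by exists [::]; split => //; rewrite big_nil. Qed.

Lemma is_word_gen x : S x -> is_word 1 x.
Proof.
move=> Sx; exists [:: x]; split => // [g|]; first by rewrite inE => /eqP ->.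
by rewrite big_seq1.
Qed.

Lemma is_wordM m n x y : is_word m x -> is_word n y -> is_word (m + n) (x * y).
Proof.
move=> [s [<- Ss <-]] [u [<- Su <-]]; exists (s ++ u); split.
- by rewrite size_cat.
- by move=> g; rewrite mem_cat => /orP[/Ss|/Su].
- by rewrite big_cat.
Qed.

Lemma word_length_subproof (genS : generates) (x : G) :
  exists n, `[< is_word n x >].
Proof. by have [n xn] := genS x; exists n; apply/asboolP. Qed.

Definition word_length (genS : generates) (x : G) : nat :=
  ex_minn (word_length_subproof genS x).

Lemma finite_words n : finite_set S -> finite_set (is_word n).
Proof.
move=> finS; elim: n => [|n IHn].
  apply: (sub_finite_set _ (finite_set1 (1 : G))) => x [s [/size0nil -> _ <-]].
  by rewrite big_nil.
apply: (sub_finite_set _ (finite_image2 (fun x y => x * y) finS IHn)).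
move=> x [[|g s] [] //= [sn] Ss <-]; rewrite big_cons.
exists g; first by apply: Ss; rewrite inE eqxx.
exists (\prod_(h <- s) h) => //; exists s; split => // h hs.
by apply: Ss; rewrite inE hs orbT.
Qed.

Lemma finite_ball (genS : generates) n : finite_set S ->
  finite_set [set x | (word_length genS x <= n)%N].
Proof.
move=> finS.
apply: (@sub_finite_set _ _ (\bigcup_(k in `I_n.+1) is_word k)).
  move=> x /=; rewrite /word_length; case: ex_minnP => m /asboolP xm _ mn.
  by exists m.
by apply: bigcup_finite => // k _; exact: finite_words.
Qed.

End WordLength.

Section Lamplighter.
Variable F : finGroupType.

(* The wreath product of F by Z. *)
Record lamplighter := Lamplighter {
  lamps : {fsfun int -> F with 1%g};
  cursor : int }.

Definition lamplighter_pair (x : lamplighter) := (lamps x, cursor x).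
Definition pair_lamplighter p := Lamplighter p.1 p.2.
Lemma lamplighter_pairK : cancel lamplighter_pair pair_lamplighter.
Proof. by case. Qed.

HB.instance Definition _ := Choice.copy lamplighter (can_type lamplighter_pairK).

(* In mulL and invL the finite domain is only an upper bound for the support;
   see mulLE and invLE. *)
Definition mulL (x y : lamplighter) : lamplighter :=
  Lamplighter
    [fsfun i in (finsupp (lamps x) `|`
                 [fset (k + cursor x)%R | k in finsupp (lamps y)])%fset
       => (lamps x i * lamps y (i - cursor x)%R)%g]
    (cursor x + cursor y).

Definition oneL : lamplighter := Lamplighter [fsfun] 0.

Definition invL (x : lamplighter) : lamplighter :=
  Lamplighter
    [fsfun i in [fset (k - cursor x)%R | k in finsupp (lamps x)]%fset
       => ((lamps x (i + cursor x)%R)^-1)%g]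
    (- cursor x).

Lemma lamplighterP (x y : lamplighter) :
  lamps x =1 lamps y -> cursor x = cursor y -> x = y.
Proof. by case: x y => [f i] [g j] /= /fsfunP -> ->. Qed.

Lemma mulLE x y i :
  lamps (mulL x y) i = (lamps x i * lamps y (i - cursor x)%R)%g.
Proof.
rewrite fsfunE; case: ifPn => //; rewrite in_fsetU negb_or => /andP[xi yi].
rewrite (fsfun_dflt xi) fsfun_dflt ?mulg1//.
apply: contra yi => yi; apply/imfsetP; exists (i - cursor x) => //.
by rewrite subrK.
Qed.

Lemma oneLE i : lamps oneL i = 1%g.
Proof. by rewrite fsfunE. Qed.

Lemma invLE x i : lamps (invL x) i = ((lamps x (i + cursor x)%R)^-1)%g.
Proof.
rewrite fsfunE; case: ifPn => // xi; rewrite fsfun_dflt ?invg1//.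
apply: contra xi => xi; apply/imfsetP; exists (i + cursor x) => //.
by rewrite addrK.
Qed.

Lemma mulLA : associative mulL.
Proof.
move=> x y z; apply: lamplighterP => [i|]; last exact: addrA.
by rewrite !mulLE mulgA opprD addrA.
Qed.

Lemma mul1L : left_id oneL mulL.
Proof.
move=> x; apply: lamplighterP => [i|]; last exact: add0r.
by rewrite mulLE oneLE mul1g subr0.
Qed.

Lemma mulL1 : right_id oneL mulL.
Proof.
move=> x; apply: lamplighterP => [i|]; last exact: addr0.
by rewrite mulLE oneLE mulg1.
Qed.

Lemma mulVL : left_inverse oneL invL mulL.
Proof.
move=> x; apply: lamplighterP => [i|]; last exact: addNr.
by rewrite mulLE oneLE invLE opprK mulVg.
Qed.

Lemma mulLV : right_inverse oneL invL mulL.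
Proof.
move=> x; apply: lamplighterP => [i|]; last exact: subrr.
by rewrite mulLE oneLE invLE subrK mulgV.
Qed.

HB.instance Definition _ :=
  isGroup.Build lamplighter mulLA mul1L mulL1 mulVL mulLV.

Definition step : lamplighter := Lamplighter [fsfun] 1.

(* delta i c has the lamp c at position i, all other lamps being trivial. *)
Definition delta (i : int) (c : F) : lamplighter :=
  Lamplighter [fsfun k in [fset i]%fset => c] 0.

Lemma deltaE i c k : lamps (delta i c) k = if k == i then c else 1%g.
Proof. by rewrite fsfunE inE. Qed.

Definition gens : set lamplighter :=
  [set step; step^-1%g] `|` [set delta 0 c | c in [set c | c != 1%g]].

Lemma gens_finite : finite_set gens.
Proof.
rewrite finite_setU; split; first exact: finite_set2.
by apply: finite_image; exact: finite_finset.
Qed.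

Lemma gens_generate : generates gens.
Proof.
pose W x := exists n, is_word gens n x.
have WM x y : W x -> W y -> W (x * y)%g.
  by move=> [m xm] [n yn]; exists (m + n)%N; exact: is_wordM.
have W1 : W 1%g by exists 0%N; exact: is_word1.
have Wg x : gens x -> W x by exists 1%N; exact: is_word_gen.
have Wtn (n : nat) : W (Lamplighter [fsfun] n%:Z) /\ W (Lamplighter [fsfun] (- n%:Z)).
  elim: n => [|n [IH1 IH2]]; first by rewrite oppr0.
  split.
    have := WM _ _ (Wg step (or_introl (or_introl erefl))) IH1.
    congr (W _); apply: lamplighterP => [i|/=]; last by rewrite intS.
    by rewrite mulLE !fsfunE mulg1.
  have := WM _ _ (Wg (step^-1)%g (or_introl (or_intror erefl))) IH2.
  congr (W _); apply: lamplighterP => [i|/=]; last by rewrite intS opprD.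
  by rewrite mulLE invLE !fsfunE invg1 mulg1.
have Wt (j : int) : W (Lamplighter [fsfun] j).
  case: j => n; first by have [] := Wtn n.
  by rewrite NegzE; have [] := Wtn n.+1.
have Wd i c : W (delta i c).
  have Wd0 : W (delta 0 c).
    have [->|c1] := eqVneq c 1%g; last by apply: Wg; right; exists c.
    have -> : delta 0 1%g = 1%g; last by [].
    by apply: lamplighterP => // k; rewrite deltaE oneLE if_same.
  have := WM _ _ (WM _ _ (Wt i) Wd0) (Wt (- i)).
  congr (W _); apply: lamplighterP => [k|/=]; last by rewrite addr0 subrr.
  by rewrite !mulLE !deltaE !fsfunE mul1g mulg1 subr_eq0.
have Wf n : forall f : {fsfun int -> F with 1%g}, #|` finsupp f| = n ->
    W (Lamplighter f 0).
  elim: n => [|n IHn] f.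
    move=> /cardfs0_eq f0; have -> : Lamplighter f 0 = 1%g; last by [].
    apply: lamplighterP => // k; rewrite oneLE/= fsfun_dflt//.
    by rewrite f0 inE.
  move=> fn; have [i fi] : exists i, i \in finsupp f.
    by apply/fset0Pn; rewrite -cardfs_gt0 fn.
  pose g : {fsfun int -> F with 1%g} := [fsfun k in (finsupp f `\ i)%fset => f k].
  have gE k : g k = if k == i then 1%g else f k.
    rewrite fsfunE !inE; have [//|ki] /= := eqVneq k i.
    by case: finsuppP.
  have gn : #|` finsupp g| = n.
    have -> : finsupp g = (finsupp f `\ i)%fset.
      apply/fsetP => k; rewrite !inE !mem_finsupp gE.
      by have [_|//] := eqVneq k i; rewrite eqxx.
    by move: fn; rewrite (cardfsD1 i) fi => -[].
  have := WM _ _ (Wd i (f i)) (IHn _ gn).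
  congr (W _); apply: lamplighterP => [k|//].
  rewrite mulLE deltaE /= subr0 gE.
  by have [->|] := eqVneq k i; rewrite ?mulg1 ?mul1g.
case=> f j; have := WM _ _ (Wf _ f erefl) (Wt j).
congr (W _); apply: lamplighterP => [k|/=]; last by rewrite add0r.
by rewrite mulLE [lamps (Lamplighter [fsfun] j) _]fsfunE mulg1.
Qed.

Definition len (x : lamplighter) : nat := word_length gens_generate x.

Definition ball_fiber (j : int) (n : nat) : set lamplighter :=
  [set x | (len x <= n)%N /\ cursor x = j].

Lemma ball_fiber_finite j n : finite_set (ball_fiber j n).
Proof.
apply: sub_finite_set (finite_ball gens_generate n gens_finite).
by move=> x [].
Qed.

Definition ball_count (j : int) (n : nat) : nat :=
  #|` fset_set (ball_fiber j n)|.

Lemma ball_count_mono j m n : (m <= n)%N -> (ball_count j m <= ball_count j n)%N.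
Proof.
move=> mn; apply: fsubset_leq_card.
rewrite -fset_set_sub; [|exact: ball_fiber_finite..].
by move=> x [xm xj]; split => //; exact: leq_trans mn.
Qed.

(* By ball_count_mono the truncated subtraction of nat is the usual one. *)
Definition sphere_count (j : int) (n : nat) : nat :=
  (ball_count j n - ball_count j n.-1)%N.

End Lamplighter.

Section Rate.
Variable R : realType.

(* ln 0 = 0, hence ent r 0 = 0 and ent r 1 = ln r. *)
Definition ent (r : nat) (u : R) : R :=
  - u * ln u - (1 - u) * ln (1 - u) + u * ln r%:R.

Definition is_rho (r : nat) (rho : R) : Prop :=
  1 < rho /\ rho ^+ 3 = rho + r%:R.

Lemma is_rho_exists_unique (r : nat) : (0 < r)%N -> exists! rho, is_rho r rho.
Proof.
move=> r0; pose s : R := r%:R; have s1 : 1 <= s by rewrite ler1n.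
pose p : {poly R} := 'X^3 - 'X - s%:P.
have pE x : p.[x] = x ^+ 3 - x - s by rewrite /p !hornerE.
have [||x /andP[x1 _] /rootP] := @poly_ivt R p 1 (1 + s).
- by rewrite lerDl; lra.
- rewrite !pE; apply/andP; split; first by lra.
  have -> : (1 + s) ^+ 3 - (1 + s) - s = s ^+ 3 + 3 * s ^+ 2 + s by ring.
  by rewrite !addr_ge0// ?mulr_ge0// ?exprn_ge0//; lra.
rewrite pE => xr; have x3 : x ^+ 3 = x + s by lra.
have {}x1 : 1 < x.
  rewrite lt_neqAle x1 andbT; apply/eqP => x1'.
  by move: x3; rewrite -x1' expr1n; lra.
exists x; split=> // y [y1]; rewrite -/s => y3.
have /eqP : (x - y) * (x ^+ 2 + x * y + y ^+ 2 - 1) = 0.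
  have -> : (x - y) * (x ^+ 2 + x * y + y ^+ 2 - 1)
            = (x ^+ 3 - x) - (y ^+ 3 - y) by ring.
  by rewrite x3 y3; ring.
rewrite mulf_eq0 subr_eq0 => /orP[/eqP//|/eqP]; nra.
Qed.

Definition u_crit (r : nat) (rho : R) : R := r%:R / (r%:R + rho).
Definition beta_crit (r : nat) (rho : R) : R := 1 / (1 + u_crit r rho).

Lemma beta_critE r rho : is_rho r rho ->
  beta_crit r rho = rho ^+ 3 / (rho ^+ 3 + r%:R).
Proof.
move=> [rho1 rho3]; rewrite /beta_crit /u_crit rho3.
have r0 : 0 <= r%:R :> R := ler0n _ _.
by field; rewrite !gt_eqF//; lra.
Qed.

Definition concave_on (D : set R) (f : R -> R) : Prop :=
  @convex_function R R^o D (fun x => - f x).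

(* The rate function has a corner pointing downwards at 0, so that it is concave
   on each of [-1, 0] and [0, 1] but not on [-1, 1]. *)
Lemma rate_not_concave (r : nat) (rho : R) (I : R -> R) :
  (0 < r)%N -> is_rho r rho ->
  (forall b, -1 <= b <= 1 -> `|b| <= beta_crit r rho ->
     I b = (1 + `|b|) * ln rho) ->
  ~ concave_on `[-1, 1] I.
Proof.
move=> r0 [rho1 _]; set b := beta_crit r rho => Ib cI.
have r1 : 1 <= r%:R :> R by rewrite ler1n.
have u0 : 0 < u_crit r rho by rewrite divr_gt0//; lra.
have b0 : 0 < b by rewrite divr_gt0//; lra.
have b1 : b <= 1 by rewrite /b /beta_crit ler_pdivrMr; lra.
have l0 : 0 < ln rho by rewrite ln_gt0.
have half : 0 <= (2^-1 : R) <= 1 by apply/andP; split; lra.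
have /andP[half0 half1] := half.
have := cI (Itv01 half0 half1) b (- b).
rewrite !inE/= !in_itv/=.
have bD : -1 <= b <= 1 by apply/andP; split; lra.
have bND : -1 <= - b <= 1 by apply/andP; split; lra.
move=> /(_ bD bND) H.
have {H} : - I (2^-1 * b + (1 - 2^-1) * - b)
         <= 2^-1 * - I b + (1 - 2^-1) * - I (- b) by exact: H.
have -> : 2^-1 * b + (1 - 2^-1) * - b = 0 :> R by lra.
rewrite (Ib b) ?(Ib (- b)) ?(Ib 0) ?normrN ?normr0 ?gtr0_norm//; last 2 first.
- by apply/andP; split; lra.
- exact: ltW.
nra.
Qed.

(* (1 / n) log (c n), where log 0 = -oo. *)
Definition log_rate (c : nat -> nat) (n : nat) : \bar R :=
  ((n%:R^-1)%:E * lne (c n)%:R%:E)%E.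

End Rate.

(* Main.v *)
(* The word length of (eta, j) is the number of lit lamps plus the length of the
   shortest walk from 0 to j visiting them all.  Inversion preserves the length
   and negates the cursor, so let j >= 0.

   Upper bound: an element of length at most n is supported in a window of
   j + m + 1 sites and has at most n - j - 2m lit lamps, for some m.  Giving each
   lit lamp the weight 1 / y with y >= rho, there are at most
   (1 + r / y)^(j + m + 1) y^(n - j - 2m) of these, and 1 + r / y <= y^2 makes
   m = 0 the worst case.  Hence the rate at slope b is at most
   growth y b = b ln (1 + r / y) + (1 - b) ln y for every y >= rho, and the
   infimum of these affine functions of b is the stated I: the infimum is
   attained at y = rho for b <= beta_crit, and at an interior critical point
   (y = oo for b = 1) above.  In particular I is concave on [0, 1].

   Lower bound: walk right to j + w, lighting k of the sites passed, light the
   turning point, and come back to j.  This produces C(j + w, k) r^k elements of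
   the same exact length, so the bound also holds for spheres; the optimal w is
   proportional to n below beta_crit and is 0 above. *)

Require Import Defs.
From HB Require Import structures.
From mathcomp Require Import all_boot all_order all_fingroup all_algebra.
From mathcomp Require Import finmap.
From mathcomp Require Import all_classical all_reals all_analysis.
From mathcomp Require Import ring lra zify.

Set Implicit Arguments.
Unset Strict Implicit.
Unset Printing Implicit Defensive.

Import Order.TTheory GRing.Theory Num.Theory.
Import numFieldNormedType.Exports.

Local Open Scope classical_set_scope.
Local Open Scope ring_scope.

(** * Words and windows *)

Section Words.
Local Open Scope group_scope.
Variables (G : groupType) (S : set G).

Lemma is_wordV n x : (forall g, S g -> S g^-1) -> is_word S n x ->
  is_word S n x^-1.
Proof.
move=> SV; elim: n x => [|n IHn] x [[|g s] [] //= sn sS <-].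
  by rewrite big_nil invg1; exact: is_word1.
rewrite big_cons invMg -addn1; apply: is_wordM.
  apply: IHn; exists s; split; [by case: sn | | by []].
  by move=> h hs; apply: sS; rewrite inE hs orbT.
by apply: is_word_gen; apply: SV; apply: sS; rewrite inE eqxx.
Qed.

Lemma word_length_le (genS : generates S) n x :
  is_word S n x -> (word_length genS x <= n)%N.
Proof.
by rewrite /word_length; case: ex_minnP => m _ + xn; apply; apply/asboolP.
Qed.

Lemma word_lengthP (genS : generates S) x : is_word S (word_length genS x) x.
Proof. by rewrite /word_length; case: ex_minnP => m /asboolP. Qed.

Lemma word_lengthV (genS : generates S) x : (forall g, S g -> S g^-1) ->
  word_length genS x^-1 = word_length genS x.
Proof.
move=> SV; apply/eqP; rewrite eqn_leq; apply/andP; split.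
  exact/word_length_le/(is_wordV SV)/word_lengthP.
rewrite -{1}[x]invgK.
exact/word_length_le/(is_wordV SV)/word_lengthP.
Qed.

End Words.

Lemma card_fset_set_le (T : choiceType) (A B : set T) (f : T -> T) :
  finite_set A -> finite_set B -> injective f ->
  (forall x, A x -> B (f x)) -> (#|` fset_set A| <= #|` fset_set B|)%N.
Proof.
move=> Afin Bfin finj fAB.
have <- : #|` [fset f x | x in fset_set A]%fset| = #|` fset_set A|.
  by rewrite card_imfset.
apply: fsubset_leq_card; apply/fsubsetP => y /imfsetP[x /= xA ->].
by rewrite in_fset_set// inE; apply: fAB; move: xA; rewrite in_fset_set// inE.
Qed.

Section LampCounts.
Variable F : finGroupType.
Implicit Types (x y : lamplighter F).

Lemma lampsM x y i : lamps (x * y)%g i = (lamps x i * lamps y (i - cursor x))%g.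
Proof. exact: mulLE. Qed.

Lemma lampsV x i : lamps (x^-1)%g i = (lamps x (i + cursor x))^-1%g.
Proof. exact: invLE. Qed.

Lemma cursorM x y : cursor (x * y)%g = cursor x + cursor y.
Proof. by []. Qed.

Lemma cursorV x : cursor (x^-1)%g = - cursor x.
Proof. by []. Qed.

Lemma gensV x : @gens F x -> @gens F (x^-1)%g.
Proof.
move=> [[->|->]|[c c1 <-]].
- by left; right.
- by left; left; rewrite invgK.
- right; exists (c^-1)%g; first by rewrite /= invg_eq1.
  apply: lamplighterP => [k|].
    by rewrite lampsV !deltaE addr0; case: eqP => //; rewrite invg1.
  by rewrite cursorV oppr0.
Qed.

Lemma ball_countN j n : ball_count F (- j) n = ball_count F j n.
Proof.
have H k : (ball_count F k n <= ball_count F (- k) n)%N.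
  apply: (@card_fset_set_le _ _ _ (fun x => x^-1)%g);
    [exact: ball_fiber_finite..|exact: invg_inj|].
  move=> x [xn <-]; split => //.
  by rewrite /len word_lengthV//; exact: gensV.
by apply/eqP; rewrite eqn_leq H andbT -{2}[j]opprK H.
Qed.

Lemma ball_count_absz j n : ball_count F j n = ball_count F `|j|%N n.
Proof.
by case: (intP j) => [|m|m] //; rewrite ball_countN abszN.
Qed.

Lemma sphere_count_absz j n : sphere_count F j n = sphere_count F `|j|%N n.
Proof. by rewrite /sphere_count !(ball_count_absz j). Qed.

(* The walk crosses each edge of the window, and crosses twice those that are not
   between 0 and the final cursor. *)
Lemma word_window n x : is_word (@gens F) n x -> exists p q : nat,
  [/\ - p%:Z <= cursor x <= q%:Z,
      forall i, lamps x i != 1%g -> - p%:Z <= i <= q%:Z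
    & (#|` finsupp (lamps x)| + 2 * (p + q) <= n + `|cursor x|)%N].
Proof.
move=> [s [<-{n} + <-{x}]].
elim/last_ind: s => [|s g IHs] sS.
  exists 0%N, 0%N; rewrite big_nil /=; split => //.
    by move=> i; rewrite oneLE eqxx.
  by rewrite finsupp0.
have [|p [q]] := IHs.
  by move=> h hs; apply: sS; rewrite mem_rcons inE hs orbT.
rewrite big_rcons size_rcons; set x := (\prod_(i <- s) i)%g.
rewrite -[monoid_mul__canonical__Monoid_Law _ x g]/(x * g)%g.
move=> [xc xl xn].
have nolamp y : lamps y =1 (fun=> 1%g) ->
    finsupp (lamps (x * y)%g) = finsupp (lamps x) /\
    (forall i, lamps (x * y)%g i = lamps x i).
  move=> y1; have E i : lamps (x * y)%g i = lamps x i by rewrite lampsM y1 mulg1.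
  by split => //; apply/fsetP => i; rewrite !mem_finsupp E.
have [[gE|gE]|[c c1 gE]] : @gens F g by apply: sS; rewrite mem_rcons inE eqxx.
- have [|sE lE] := nolamp g; first by move=> i; rewrite gE fsfunE.
  have -> : cursor (x * g)%g = cursor x + 1 by rewrite gE.
  (* The window grows only when the step leaves it: the new edge costs [2], paid by the letter and
     by the growth of the absolute value of the cursor. Otherwise that absolute value drops by at
     most [1], which the letter covers. *)
  exists p, (if cursor x == q then q.+1 else q).
  rewrite sE; split.
  + by case: eqP => ?; lia.
  + by move=> i; rewrite lE => /xl; case: eqP => ?; lia.
  + by move: xn xc; case: eqP => ?; lia.
- have [|sE lE] := nolamp g; first by move=> i; rewrite gE lampsV fsfunE invg1.
  have -> : cursor (x * g)%g = cursor x - 1 by rewrite gE.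
  exists (if cursor x == - p%:Z then p.+1 else p), q.
  rewrite sE; split.
  + by case: eqP => ?; lia.
  + by move=> i; rewrite lE => /xl; case: eqP => ?; lia.
  + by move: xn xc; case: eqP => ?; lia.
- have -> : cursor (x * g)%g = cursor x by rewrite -gE /= addr0.
  have lE i : i != cursor x -> lamps (x * g)%g i = lamps x i.
    by rewrite lampsM -gE deltaE subr_eq0 => /negPf ->; rewrite mulg1.
  exists p, q; split => //.
  + by move=> i; have [->//|/lE ->] := eqVneq i (cursor x); exact: xl.
  + rewrite addSn; apply: leq_trans (_ :
      #|` (cursor x |` finsupp (lamps x))%fset| + 2 * (p + q) <= _)%N.
      rewrite leq_add2r; apply: fsubset_leq_card; apply/fsubsetP => i.
      rewrite in_fset1U !mem_finsupp.
      by have [//|/lE ->] := eqVneq i (cursor x).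
    by rewrite cardfsU1; case: (_ \notin _); lia.
Qed.

End LampCounts.

(** * Lower bound on the spheres *)

Section Counting.
Variable F : finGroupType.

Lemma card_le_fset_set (T : finType) (U : choiceType) (A : {set T})
    (phi : T -> U) (S : set U) : finite_set S ->
  {in A &, injective phi} -> (forall t, t \in A -> S (phi t)) ->
  (#|A| <= #|` fset_set S|)%N.
Proof.
move=> Sfin phi_inj phiS; rewrite cardE -(size_map phi) uniq_leq_size//.
  rewrite map_inj_in_uniq ?enum_uniq// => s t.
  by rewrite !mem_enum; exact: phi_inj.
move=> u /mapP[t]; rewrite mem_enum => tA ->.
by rewrite in_fset_set// inE; exact: phiS.
Qed.

Definition ffsupp (I : finType) (f : {ffun I -> F}) : {set I} :=
  [set i | f i != 1%g]%SET.

(** Sort the functions by support: there are ['C(#|I|, k)] supports of size [k], and each site of a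
    support carries one of [#|F|.-1] nontrivial values. *)
Lemma card_ffsupp (I : finType) k :
  #|[set f : {ffun I -> F} | #|ffsupp f| == k]%SET|
    = ('C(#|I|, k) * #|F|.-1 ^ k)%N.
Proof.
rewrite -sum1dep_card (partition_big (@ffsupp I) (fun D => #|D| == k))//=.
rewrite (eq_bigr (fun=> #|F|.-1 ^ k)%N) => [|D /eqP Dk].
  by rewrite sum_nat_const -cardsE card_draws.
rewrite -Dk; have -> : #|F|.-1 = #|predC1 (1%g : F)|.
  by rewrite cardC1.
rewrite -(card_pffun_on (1%g : F)) -[RHS]sum1_card.
apply: eq_bigl => f.
apply/andP/pffun_onP => [[_ /eqP <-]|[/fintype.subsetP sD fD]].
  split; first by apply/fintype.subsetP => i; rewrite !inE.
  by move=> y /fintype.imageP[i iD ->]; move: iD; rewrite !inE.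
have E : ffsupp f = D.
  apply/setP => i; rewrite inE; apply/idP/idP => [/sD//|iD].
  by apply: fD; apply/fintype.imageP; exists i.
by rewrite E Dk eqxx.
Qed.

Definition sphere_fiber j n : set (lamplighter F) :=
  [set x | len x = n /\ cursor x = j].

Lemma sphere_fiber_finite j n : finite_set (sphere_fiber j n).
Proof.
by apply: sub_finite_set (ball_fiber_finite F j n) => x [<- <-]; split.
Qed.

(** At [n = 0] the predecessor is again [0] and [sphere_count] vanishes, although the identity has
    length [0]. *)
Lemma sphere_countE j n :
  (0 < n)%N -> sphere_count F j n = #|` fset_set (sphere_fiber j n)|.
Proof.
case: n => // n _; rewrite /sphere_count /ball_count /=.
have fin := @ball_fiber_finite F j.
rewrite -cardfsDS; last first.
  by rewrite -fset_set_sub// => x [xn xj]; split => //; exact: leqW.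
rewrite -fset_setD//; congr (#|` fset_set _|); apply/seteqP; split => x /=.
  by move=> [[xn xj] /not_andP[|//]]; split => //; lia.
by move=> [xn xj]; split; [split => //; lia|move=> [+ _]; lia].
Qed.

Lemma sum_finsupp (f : {fsfun int -> F with 1%g}) n :
  (\sum_(k < n) (f k%:Z != 1%g) <= #|` finsupp f|)%N.
Proof.
rewrite -big_mkcond/= sum1dep_card.
rewrite -(set_fsetK (finsupp f)).
apply: (@card_le_fset_set _ _ _ (fun k : 'I_n => k%:Z)) => //.
  by move=> s t _ _ [/val_inj].
by move=> k; rewrite inE /= mem_finsupp.
Qed.

(** [delta 0] acts at the cursor, so [g m] is written at site [m] before the step to [m.+1]; site
    [n], where the sweep ends, stays unlit. *)
Fixpoint sweep (g : nat -> F) n : lamplighter F :=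
  if n is m.+1 then (sweep g m * delta 0 (g m) * step F)%g else 1%g.

Lemma sweepS g n : sweep g n.+1 = (sweep g n * delta 0 (g n) * step F)%g.
Proof. by []. Qed.

Lemma cursor_sweep g n : cursor (sweep g n) = n.
Proof.
elim: n => // n IHn.
by rewrite sweepS !cursorM IHn /= addr0 intS addrC.
Qed.

Lemma lamps_sweep g n i : lamps (sweep g n) i =
  if i is Posz k then if (k < n)%N then g k else 1%g else 1%g.
Proof.
elim: n => [|n IHn]; first by case: i => // k; exact: oneLE.
rewrite sweepS !lampsM IHn deltaE fsfunE /= mulg1 subr_eq0 cursor_sweep.
case: i {IHn} => [k|k] //; last by rewrite mulg1.
rewrite -[Posz k == Posz n]/(k == n) ltnS.
by case: ltngtP => [| |->]; rewrite ?mulg1 ?mul1g.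
Qed.

Lemma is_word_delta (c : F) : is_word (@gens F) (c != 1%g) (delta 0 c).
Proof.
have [->|c1] := eqVneq c 1%g; last by apply: is_word_gen; right; exists c.
have -> : delta 0 (1 : F)%g = 1%g; last exact: is_word1.
by apply: lamplighterP => // k; rewrite deltaE oneLE if_same.
Qed.

Lemma is_word_sweep (g : nat -> F) n :
  is_word (@gens F) (n + \sum_(k < n) (g k != 1%g)) (sweep g n).
Proof.
elim: n => [|n IHn]; first by rewrite big_ord0; exact: is_word1.
rewrite sweepS big_ord_recr/= addnA -addn1 [(n + 1 + _)%N]addnAC addnAC.
apply: is_wordM; last by apply: is_word_gen; left; left.
by apply: is_wordM => //; exact: is_word_delta.
Qed.

Lemma is_word_back n : is_word (@gens F) n (Lamplighter [fsfun] (- n%:Z)).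
Proof.
elim: n => [|n IHn]; first by rewrite oppr0; exact: is_word1.
have gV : @gens F (step F)^-1%g by left; right.
have := is_wordM (is_word_gen gV) IHn.
rewrite add1n; congr (is_word _ _ _); apply: lamplighterP => [i|].
  by rewrite lampsM lampsV !fsfunE invg1 mulg1.
by rewrite cursorM cursorV /= intS opprD.
Qed.

(* Go right from 0 to j + w setting the lamps to g, set the lamp at j + w to c,
   and return to j. *)
Definition excursion g j w c : lamplighter F :=
  (sweep g (j + w) * delta 0 c * Lamplighter [fsfun] (- w%:Z))%g.

Lemma cursor_excursion g j w c : cursor (excursion g j w c) = j.
Proof.
by rewrite !cursorM cursor_sweep /= addr0 PoszD addrK.
Qed.

Lemma lamps_excursion g j w c (k : nat) : lamps (excursion g j w c) k =
  if (k < j + w)%N then g k else if k == (j + w)%N then c else 1%g.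
Proof.
rewrite !lampsM [in X in (_ * X)%g]fsfunE mulg1 lamps_sweep deltaE cursor_sweep.
rewrite subr_eq0 -[Posz k == _]/(k == (j + w)%N).
by case: ltngtP => _; rewrite ?mulg1 ?mul1g.
Qed.

(* If w > 0, the lamp at the turning point has to be lit: otherwise turning
   earlier would be shorter. *)
Lemma len_excursion (g : nat -> F) j w c : (c != 1%g) || (w == 0%N) ->
  len (excursion g j w c) =
    (j + w.*2 + \sum_(k < j + w) (g k != 1%g) + (c != 1%g))%N.
Proof.
move=> cw; apply/eqP; rewrite eqn_leq; apply/andP; split.
  have := is_wordM (is_wordM (is_word_sweep g (j + w)) (is_word_delta c))
    (is_word_back w).
  move=> /(word_length_le (@gens_generate F)) /leq_trans -> //.
  by rewrite -addnn; move: (\sum_(k < _) _)%N (nat_of_bool _) => m b; lia.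
have [p [q [cq lq]]] :=
  word_window (word_lengthP (@gens_generate F) (excursion g j w c)).
rewrite -/(len _) cursor_excursion.
have := sum_finsupp (lamps (excursion g j w c)) (j + w).+1.
rewrite big_ord_recr /= lamps_excursion ltnn eqxx.
under eq_bigr => k _ do rewrite lamps_excursion ltn_ord.
(* The window must reach [j + w]: either the lamp there is lit, or [w = 0] and the final cursor is
   [j]. The edges beyond [j] are then paid for twice. *)
have : (j + w <= q)%N.
  case/orP: cw => [c1|/eqP w0].
    by have := lq (j + w)%N; rewrite lamps_excursion ltnn eqxx => /(_ c1); lia.
  by move: cq; rewrite cursor_excursion w0; lia.
move: lq => _; move: cq => _.
move: (\sum_(k < _) _)%N (nat_of_bool _) => m b; lia.
Qed.

(** With [j], [w] and [c] fixed, all excursions lighting exactly [k] of the first [j + w] sites have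
    the same length, and an excursion determines its lamps; [card_ffsupp] counts them. *)
Lemma sphere_count_ge j w k (c : F) : (c != 1%g) || (w == 0%N) ->
  (0 < j + w.*2 + k + (c != 1%g))%N ->
  ('C(j + w, k) * #|F|.-1 ^ k
     <= sphere_count F j (j + w.*2 + k + (c != 1%g)))%N.
Proof.
move=> cw n0; rewrite sphere_countE// -{1}(card_ord (j + w)) -card_ffsupp.
pose g (f : {ffun 'I_(j + w) -> F}) k := if insub k is Some i then f i else 1%g.
have gE f (i : 'I_(j + w)) : g f i = f i by rewrite /g valK.
apply: (@card_le_fset_set _ _ _ (fun f => excursion (g f) j w c)).
- exact: sphere_fiber_finite.
- move=> f1 f2 _ _ f12; apply/ffunP => i.
  have := lamps_excursion (g f1) j w c i; rewrite f12 lamps_excursion.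
  by rewrite ltn_ord !gE => ->.
- move=> f; rewrite inE => /eqP fk; split; last exact: cursor_excursion.
  rewrite len_excursion//; congr (_ + _ + _)%N; rewrite -fk -sum1dep_card.
  by rewrite [RHS]big_mkcond; apply: eq_bigr => i _; rewrite gE; case: (_ != _).
Qed.

End Counting.

(** * Upper bound on the balls *)

Section UpperBound.
Variables (R : realFieldType) (F : finGroupType).

(** The generating function of the number of lit lamps factors over the sites: a site of [D]
    contributes [1] if unlit and [z] for each nontrivial value, a site outside [D] only [1]. *)
Lemma sum_exp_ffsupp (I : finType) (D : {set I}) (z : R) :
  \sum_(f : {ffun I -> F} | ffsupp f \subset D) z ^+ #|ffsupp f|
    = (1 + #|F|.-1%:R * z) ^+ #|D|.
Proof.
pose wt (c : F) : R := if c != 1%g then z else 1.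
have wtE : \sum_(c : F | predT c) wt c = 1 + #|F|.-1%:R * z.
  rewrite (bigD1 (1%g : F))//= /wt eqxx; congr (_ + _).
  rewrite (eq_bigr (fun=> z)) => [|c ->//].
  by rewrite sumr_const cardC1 mulr_natl.
rewrite -wtE -prodr_const (big_distr_big_dep (1%g : F) (mem D) (fun=> predT)).
apply: eq_big => [f|f /fintype.subsetP fD].
  apply/fintype.subsetP/pfamilyP => [fD|[/fintype.subsetP fD _] i].
    by split => //; apply/fintype.subsetP => i fi; apply: fD; rewrite inE.
  by rewrite inE; exact: fD.
rewrite -prodr_const [RHS](big_setID (ffsupp f))/= [X in _ = _ * X]big1 => [|i].
  rewrite mulr1; apply: eq_big => [i|i].
    by rewrite finset.in_setI; apply/idP/andP => [fi|[]//]; split=> //; exact: fD.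
  by rewrite inE /wt => ->.
by rewrite !inE negbK => /andP[/eqP fi _]; rewrite /wt fi eqxx.
Qed.

Lemma card_fset_set_le_fin (T : finType) (U : choiceType) (A : {set T})
    (phi : U -> T) (S : set U) : finite_set S ->
  {in S &, injective phi} -> (forall u, S u -> phi u \in A) ->
  (#|` fset_set S| <= #|A|)%N.
Proof.
move=> Sfin phi_inj phiA; rewrite [#|A|]cardE.
rewrite -(size_map phi) uniq_leq_size//.
  rewrite map_inj_in_uniq ?fset_uniq// => s t.
  by rewrite !in_fset_set//; exact: phi_inj.
move=> u /mapP[t]; rewrite in_fset_set// inE mem_enum => tS ->.
exact: phiA.
Qed.

Lemma card_ord_itv W a m : (#|[set i : 'I_W | (a <= i < a + m)%N]%SET| <= m)%N.
Proof.
rewrite cardE -(size_map val) -[m in leqRHS](size_iota a).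
rewrite uniq_leq_size ?map_inj_uniq ?enum_uniq//.
by move=> k /mapP[i + ->]; rewrite mem_enum inE mem_iota.
Qed.

(** * Coding a ball fiber by configurations on a finite window *)

Section Window.
Variables (j n : nat).
Local Notation W := (j + n.*2).+1.

(** Index [i] stands for position [i - n], so that [window (p, q)] covers the positions from [- p]
    to [j + q]. *)
Let window (pq : 'I_n.+1 * 'I_n.+1) : {set 'I_W} :=
  [set i : 'I_W | (n - pq.1 <= i < n - pq.1 + (j + pq.1 + pq.2).+1)%N]%SET.

Let fits (f : {ffun 'I_W -> F}) pq :=
  (ffsupp f \subset window pq)
  && (#|ffsupp f| + j + 2 * (pq.1 + pq.2) <= n)%N.

Let code (x : lamplighter F) : {ffun 'I_W -> F} :=
  [ffun i : 'I_W => lamps x (i%:Z - n%:Z)].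

(** The cursor is fixed and all lit lamps lie between [- n] and [j + n], so [code] is injective on
    the fiber. *)
Lemma ball_count_le_card :
  (ball_count F j n <= #|[set f | [exists pq, fits f pq]]%SET|)%N.
Proof.
have fiberP (x : lamplighter F) : ball_fiber j n x -> exists p q : nat,
    (forall i, lamps x i != 1%g -> - p%:Z <= i <= (j + q)%N%:Z) /\
    (#|` finsupp (lamps x)| + j + 2 * (p + q) <= n)%N.
  move=> [xn xj].
  have [p [q [cx lx]]] := word_window (word_lengthP (@gens_generate F) x).
  rewrite -/(len x) xj absz_nat => sx; rewrite xj in cx.
  (* The window contains the final cursor [j], so [q - j] is the true overshoot to the right. *)
  exists p, (q - j)%N; split; last by lia.
  by move=> i /lx; lia.
apply: (card_fset_set_le_fin (phi := code)); first exact: ball_fiber_finite.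
  move=> x y; rewrite !inE => xS yS xy; apply: lamplighterP => [i|].
    have [p [q [lx sx]]] := fiberP _ xS; have [p' [q' [ly sy]]] := fiberP _ yS.
    have [iW|iW] := boolP (- n%:Z <= i <= (j + n)%N%:Z); last first.
      transitivity (1 : F)%g; first apply/eqP; last apply/esym/eqP.
        by apply: contraNT iW => /lx; lia.
      by apply: contraNT iW => /ly; lia.
    have kW : (absz ((i : int) + n%:Z)%R < W)%N by lia.
    have := congr1 (fun f : {ffun 'I_W -> F} => f (Ordinal kW)) xy.
    by rewrite !ffunE /=;
    have -> : (absz ((i : int) + n%:Z)%R)%:Z - n%:Z = i by lia.
  by case: xS yS => _ -> [_ ->].
move=> x /fiberP[p [q [lx sx]]]; rewrite inE; apply/existsP.
have pn : (p < n.+1)%N by lia.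
have qn : (q < n.+1)%N by lia.
exists (Ordinal pn, Ordinal qn); apply/andP; split => /=.
  by apply/fintype.subsetP => i; rewrite !inE ffunE /= => /lx; lia.
apply: leq_trans sx; rewrite !leq_add2r -(set_fsetK (finsupp (lamps x))).
apply: (@card_le_fset_set _ _ _ (fun i : 'I_W => i%:Z - n%:Z)) => //.
  by move=> s t _ _ st; apply/val_inj; move: st => /=; lia.
by move=> i; rewrite inE ffunE /= mem_finsupp.
Qed.

(** A configuration that fits [(p, q)] has weight [wt] at least [1]. By [sum_exp_ffsupp] the weights
    for one pair sum to at most [y ^+ (n - j - 2 * (p + q)) * s ^+ (j.+1 + (p + q))], and
    [s <= y ^+ 2] absorbs [s ^+ (p + q)]. The factor [n.+1 ^+ 2] counts the pairs. *)
Lemma ball_count_le (y : R) : (j <= n)%N -> 1 <= y ->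
  1 + #|F|.-1%:R / y <= y ^+ 2 ->
  (ball_count F j n)%:R <=
    n.+1%:R ^+ 2 * ((1 + #|F|.-1%:R / y) ^+ j.+1 * y ^+ (n - j)) :> R.
Proof.
move=> jn y1 ry; set b := _ * y ^+ _; set s := 1 + _ in ry b *.
have y0 : 0 < y by lra.
have s1 : 1 <= s by rewrite lerDl divr_ge0//; lra.
have b0 : 0 <= b by rewrite mulr_ge0// exprn_ge0//; lra.
pose wt (f : {ffun 'I_W -> F}) (pq : 'I_n.+1 * 'I_n.+1) : R :=
  y ^+ (n - j - 2 * (pq.1 + pq.2)) * y^-1 ^+ #|ffsupp f|.
have wt0 f pq : 0 <= wt f pq by rewrite mulr_ge0// exprn_ge0// ?invr_ge0 ltW.
have wt1 f pq : fits f pq -> 1 <= wt f pq.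
  move=> /andP[_ fn]; rewrite /wt exprVn ler_pdivlMr ?exprn_gt0// mul1r.
  by rewrite ler_weXn2l//; lia.
apply: (@le_trans _ _
  (\sum_(f : {ffun 'I_W -> F}) \sum_(pq | fits f pq) wt f pq)).
  apply: (@le_trans _ _ (#|[set f | [exists pq, fits f pq]]%SET|%:R)).
    by rewrite ler_nat ball_count_le_card.
  rewrite -sum1_card natr_sum big_mkcond; apply: ler_sum => f _.
  case: ifPn => [|_]; last by rewrite sumr_ge0.
  rewrite inE => /existsP[pq fpq]; rewrite (bigD1 pq)//=.
  by rewrite (le_trans (wt1 _ _ fpq))// lerDl sumr_ge0.
rewrite (exchange_big_dep xpredT)//=.
apply: (@le_trans _ _ (\sum_(pq : 'I_n.+1 * 'I_n.+1) b)); last first.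
  by rewrite sumr_const card_prod !card_ord -[leLHS]mulr_natl natrM expr2.
apply: ler_sum => pq _.
(* If the walk alone is longer than [n], nothing fits; otherwise the truncated subtraction in the
   exponent is exact. *)
have [jpq|jpq] := leqP (j + 2 * (pq.1 + pq.2)) n; last first.
  by rewrite big1// => f /andP[_]; lia.
rewrite -mulr_sumr.
apply: (@le_trans _ _ (y ^+ (n - j - 2 * (pq.1 + pq.2)) *
    (s ^+ (j.+1 + (pq.1 + pq.2))))).
  rewrite ler_wpM2l ?exprn_ge0 ?(ltW y0)//.
  apply: (@le_trans _ _ (s ^+ #|window pq|)); last first.
    rewrite ler_weXn2l// (leq_trans (card_ord_itv _ _ _))//; lia.
  rewrite -sum_exp_ffsupp big_mkcond [leRHS]big_mkcond; apply: ler_sum => f _.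
  rewrite /fits; case: ifP => [/andP[->]//|_]; case: ifP => // _.
  by rewrite exprn_ge0// invr_ge0 ltW.
rewrite exprD mulrCA /b ler_wpM2l//; first by rewrite exprn_ge0//; lra.
rewrite [in leRHS](_ : n - j = n - j - 2 * (pq.1 + pq.2) + 2 * (pq.1 + pq.2))%N.
  rewrite [leRHS]exprD ler_wpM2l ?exprn_ge0 ?(ltW y0)// exprM.
  by rewrite lerXn2r// nnegrE; [lra|rewrite exprn_ge0// ltW].
lia.
Qed.

End Window.
End UpperBound.

(** * The rate function *)

Section RateFunction.
Variables (R : realType) (r : nat) (rho : R).
Hypotheses (r0 : (0 < r)%N) (hrho : is_rho r rho).

Lemma rho_facts : [/\ 1 < rho, rho ^+ 3 = rho + r%:R & 1 <= r%:R :> R].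
Proof. by case: hrho => ? ?; split => //; rewrite ler1n. Qed.

(** The exponential rate of the bound in [ball_count_le] when [j / n] tends to [b]. *)
Definition growth (y b : R) : R := b * ln (1 + r%:R / y) + (1 - b) * ln y.

Definition rate (b : R) : R :=
  if b <= beta_crit r rho then (1 + b) * ln rho else b * ent r ((1 - b) / b).

Lemma ln_le_subr1 (x : R) : 0 < x -> ln x <= x - 1.
Proof.
move=> x0; have := @le_ln1Dx R (x - 1); rewrite addrCA subrr addr0; apply.
lra.
Qed.

(* Gibbs' inequality; ent_eq gives the point of equality. *)
Lemma ent_le (y u : R) : 0 < y -> 0 <= u < 1 ->
  ent r u <= ln (1 + r%:R / y) + u * ln y.
Proof.
have rR : 1 <= r%:R :> R by rewrite ler1n.
move=> y0 /andP[u0 u1]; have ry : 0 < r%:R / y.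
  rewrite divr_gt0//.
  lra.
set s := 1 + r%:R / y; have s0 : 0 < s by rewrite /s; lra.
(* The distribution [(1 - u, u)] is compared with [(1 / s, r / (y s))], term by term, through
   [ln x <= x - 1]; both have total mass [1], so the right-hand sides of [H1] and [H2] cancel. *)
have H1 : - ((1 - u) * ln (1 - u)) - (1 - u) * ln s <= s^-1 - (1 - u).
  have : ln ((s * (1 - u))^-1) <= (s * (1 - u))^-1 - 1.
    by apply: ln_le_subr1; rewrite invr_gt0 mulr_gt0//; lra.
  rewrite lnV ?posrE ?mulr_gt0//; last by lra.
  rewrite lnM ?posrE//; last by lra.
  move=> /(ler_wpM2l (_ : 0 <= 1 - u)) => /(_ ltac:(lra)).
  rewrite [in leRHS]mulrBr invfM mulrCA divff ?mulr1; last by rewrite gt_eqF//; lra.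
  by lra.
have H2 : - (u * ln u) + u * ln r%:R - u * ln s - u * ln y <= r%:R / y / s - u.
  have [->|un0] := eqVneq u 0.
    by rewrite !mul0r !subr0 oppr0 addr0 divr_ge0// ltW.
  have {}u0 : 0 < u by rewrite lt_neqAle eq_sym un0.
  have : ln (r%:R / y / s / u) <= r%:R / y / s / u - 1.
    by apply: ln_le_subr1; rewrite !divr_gt0//; lra.
  rewrite !ln_div ?posrE ?divr_gt0//; try lra.
  move=> /(ler_wpM2l (ltW u0)).
  by rewrite [in leRHS]mulrBr mulrCA divff// !mulr1; lra.
have : s^-1 + r%:R / y / s = 1 by rewrite -[X in X + _]mul1r -mulrDl divff ?gt_eqF.
rewrite /ent; lra.
Qed.

Lemma ent_eq (u : R) : 0 < u < 1 -> let y := r%:R * (1 - u) / u in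
  ent r u = ln (1 + r%:R / y) + u * ln y.
Proof.
have rR : 1 <= r%:R :> R by rewrite ler1n.
move=> /andP[u0 u1] y.
have u1' : 0 < 1 - u by lra.
have -> : 1 + r%:R / y = (1 - u)^-1.
  by rewrite /y; field; rewrite !gt_eqF//; lra.
rewrite lnV ?posrE// /y ln_div ?posrE ?mulr_gt0//; try lra.
by rewrite lnM ?posrE//; [rewrite /ent; lra|lra].
Qed.

(** The cubic equation for [rho] amounts to [1 + r / rho = rho ^+ 2]. *)
Lemma growth_rho b : growth rho b = (1 + b) * ln rho.
Proof.
have [rho1 rho3 rR] := rho_facts.
rewrite /growth; have -> : 1 + r%:R / rho = rho ^+ 2.
  have -> : r%:R = rho ^+ 3 - rho by rewrite rho3; lra.
  by field; rewrite gt_eqF//; lra.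
by rewrite lnXn; [rewrite -mulr_natl; lra|lra].
Qed.

(** After multiplication by [y]: the cubic [y ^+ 3 - y - r] is nonnegative to the right of its root
    [rho]. This makes [ball_count_le] applicable to all [y >= rho]. *)
Lemma growth_sqr (y : R) : rho <= y -> 1 + r%:R / y <= y ^+ 2.
Proof.
have [rho1 rho3 rR] := rho_facts.
move=> ry; rewrite -(ler_pM2r (_ : 0 < y)); last by lra.
rewrite mulrDl divfK ?gt_eqF//; last by lra.
rewrite mul1r -exprSr -subr_ge0.
have -> : y ^+ 3 - (y + r%:R) = (y - rho) * (y ^+ 2 + y * rho + rho ^+ 2 - 1).
  have -> : r%:R = rho ^+ 3 - rho by rewrite rho3; lra.
  by ring.
by rewrite mulr_ge0//; nra.
Qed.

Let u := u_crit r rho.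

Lemma u_crit_itv : 0 < u < 1.
Proof.
have [rho1 rho3 rR] := rho_facts.
rewrite /u /u_crit divr_gt0//=; [|lra..].
by rewrite ltr_pdivrMr; lra.
Qed.

Lemma beta_crit_itv : 2^-1 < beta_crit r rho < 1.
Proof.
have /andP[u0 u1] := u_crit_itv.
rewrite /beta_crit -/u !mul1r ltf_pV2 ?posrE ?invf_lt1; lra.
Qed.

Lemma beta_crit_u : (1 - beta_crit r rho) / beta_crit r rho = u.
Proof.
have /andP[u0 u1] := u_crit_itv.
by rewrite /beta_crit -/u; field; rewrite !gt_eqF//; lra.
Qed.

(** At [u_crit] the equality point of [ent_eq] is [rho] itself, which is why the two branches of
    [rate] meet at [beta_crit]. *)
Lemma ent_u_crit : ent r u = (2 + u) * ln rho.
Proof.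
have [rho1 _ rR] := rho_facts; rewrite (ent_eq u_crit_itv).
have -> : r%:R * (1 - u) / u = rho.
  by rewrite /u /u_crit; field; rewrite !gt_eqF//; lra.
have := growth_rho 1; rewrite /growth subrr mul0r addr0 mul1r /= => ->; lra.
Qed.

Lemma rate_low b : b <= beta_crit r rho -> rate b = (1 + b) * ln rho.
Proof. by rewrite /rate => ->. Qed.

Lemma rate_high b : beta_crit r rho <= b -> rate b = b * ent r ((1 - b) / b).
Proof.
rewrite /rate; case: ltgtP => // <- _; rewrite beta_crit_u ent_u_crit.
have /andP[u0 u1] := u_crit_itv.
by rewrite /beta_crit -/u; field; rewrite !gt_eqF//; lra.
Qed.

Lemma high_itv b : beta_crit r rho <= b <= 1 ->
  [/\ 0 < b, 0 <= (1 - b) / b < 1 & (1 - b) / b <= u].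
Proof.
have /andP[c0 c1] := beta_crit_itv; move=> /andP[cb b1].
have b0 : 0 < b by lra.
split => //; first by rewrite ltr_pdivrMr// divr_ge0//; lra.
rewrite -beta_crit_u ler_pdivrMr// mulrAC ler_pdivlMr; nra.
Qed.

(** Above [beta_crit] this is [ent_le] multiplied by [b]. Below, both sides are affine in [b], so it
    suffices to compare them at [beta_crit], by the first case, and at [0], where
    [ln rho <= ln y]. *)
Lemma rate_le_growth (y b : R) : rho <= y -> 0 <= b <= 1 ->
  rate b <= growth y b.
Proof.
have [rho1 rho3 rR] := rho_facts.
move=> ry.
have high c : beta_crit r rho <= c <= 1 -> rate c <= growth y c.
  move=> /[dup] /andP[cb _] /high_itv[c0 cu _].
  rewrite rate_high// /growth.
  have := ent_le (_ : 0 < y) cu => /(_ ltac:(lra)).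
  move=> /(ler_wpM2l (ltW c0)) /le_trans; apply.
  by rewrite mulrDr mulrA [c * (_ / _)]mulrC divfK ?gt_eqF.
move=> /andP[b0 b1]; have [cb|bc] := leP (beta_crit r rho) b.
  by apply: high; rewrite cb.
have /andP[c0 c1] := beta_crit_itv.
have := high (beta_crit r rho); rewrite lexx (ltW c1) => /(_ isT).
rewrite !rate_low ?(ltW bc)// /growth.
have : ln rho <= ln y by rewrite ler_ln ?posrE//; lra.
move: bc b0; set c := beta_crit r rho; set A := ln (1 + _); set B := ln y.
set C := ln rho => bc b0 CB.
move=> H; have c0' : 0 < c by rewrite /c; lra.
rewrite -(ler_pM2l c0'); nra.
Qed.

Lemma growth_approx (b e : R) : 0 <= b <= 1 -> 0 < e ->
  exists2 y, rho <= y & growth y b <= rate b + e.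
Proof.
have [rho1 rho3 rR] := rho_facts.
move=> /andP[b0 b1] e0.
have [bc|cb] := leP b (beta_crit r rho).
  by exists rho; rewrite // growth_rho rate_low//; lra.
have [|b0' /andP[u0 u1] uu] := @high_itv b; first by rewrite (ltW cb).
rewrite rate_high ?(ltW cb)//.
have [->|bn1] := eqVneq b 1.
  (* At [b = 1] the infimum is only approached as [y] grows: [growth y 1 = ln (1 + r / y) <= r / y
     <= e]. *)
  exists (Num.max rho (r%:R / e)); first by rewrite le_max lexx.
  set y := Num.max _ _; have y0 : 0 < y by rewrite lt_max; apply/orP; left; lra.
  rewrite /growth subrr !mul0r !mul1r addr0.
  have -> : ent r (0 : R) = 0.
    by rewrite /ent subr0 ln1 oppr0 !mul0r mulr0 subr0 addr0.
  rewrite add0r (le_trans (le_ln1Dx _))//.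
    by rewrite (lt_le_trans (ltrN10 R))// divr_ge0//; lra.
  by rewrite ler_pdivrMr// mulrC -ler_pdivrMr// le_max lexx orbT.
set v := (1 - b) / b in u0 u1 uu *.
have v0 : 0 < v by rewrite divr_gt0// subr_gt0 lt_neqAle bn1.
(* The equality point of [ent_eq]; it is at least [rho] because [v <= u_crit]. *)
exists (r%:R * (1 - v) / v).
  rewrite ler_pdivlMr//; move: uu; rewrite /u /u_crit.
  by rewrite ler_pdivlMr; nra.
have bv : b * v = 1 - b by rewrite mulrC divfK ?gt_eqF.
by rewrite ent_eq ?v0//= /growth [b * (_ + _)]mulrDr [b * (v * _)]mulrA bv lerDl ltW.
Qed.

Lemma growth_convex_comb y (t a b : R) :
  growth y (t * a + (1 - t) * b) = t * growth y a + (1 - t) * growth y b.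
Proof. by rewrite /growth; ring. Qed.

(** One [y] nearly optimal at the convex combination bounds [rate] at both end points, and
    [growth y] is affine. *)
Lemma rate_concave (t a b : R) : 0 <= t <= 1 -> 0 <= a <= 1 -> 0 <= b <= 1 ->
  t * rate a + (1 - t) * rate b <= rate (t * a + (1 - t) * b).
Proof.
move=> /andP[t0 t1] a01 b01; apply/ler_addgt0Pr => e e0.
have [|y ry] := @growth_approx (t * a + (1 - t) * b) e _ e0.
  by case/andP: a01 b01 => ? ? /andP[? ?]; apply/andP; split; nra.
apply: le_trans; rewrite growth_convex_comb.
by rewrite lerD// ler_wpM2l ?rate_le_growth//; lra.
Qed.

End RateFunction.

(** * Asymptotics *)

(* M ^ M = (k + (M - k)) ^ M expands into M.+1 terms, the k-th being the largest. *)
Lemma modal_binomial_term M k : (k <= M)%N ->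
  (M ^ M <= M.+1 * ('C(M, k) * ((M - k) ^ (M - k) * k ^ k)))%N.
Proof.
move=> kM; pose t i := ('C(M, i) * ((M - k) ^ (M - i) * k ^ i))%N.
(* Up to a common factor, [t i] and [t i.+1] compare as [(i + 1) (M - k)] and [(M - i) k]: the terms
   do not decrease up to index [k] and do not increase after it. *)
have tS i : (i < M)%N -> exists c,
    (i.+1 * t i = c * (i.+1 * (M - k)))%N /\ (i.+1 * t i.+1 = c * ((M - i) * k))%N.
  move=> iM; exists ('C(M, i) * ((M - k) ^ (M - i.+1) * k ^ i))%N; split.
    by rewrite /t -(subnSK iM) expnS; lia.
  by rewrite /t mulnA mul_bin_left expnS; lia.
have up d : forall i, (i + d = k)%N -> (t i <= t k)%N.
  elim: d => [i|d IHd i id]; first by rewrite addn0 => ->.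
  apply: leq_trans (IHd i.+1 _); last by lia.
  have [|c [cl cr]] := tS i; first by lia.
  by rewrite -(leq_pmul2l (ltn0Sn i)) cl cr leq_mul2l; apply/orP; right; nia.
have down d : (k + d <= M)%N -> (t (k + d) <= t k)%N.
  elim: d => [|d IHd kd]; first by rewrite addn0.
  apply: leq_trans (IHd _); last by lia.
  rewrite addnS; have [|c [cl cr]] := tS (k + d)%N; first by lia.
  by rewrite -(leq_pmul2l (ltn0Sn (k + d))) cl cr leq_mul2l; apply/orP; right; nia.
rewrite -{1}(subnK kM) expnDn -[X in (X * _)%N](card_ord M.+1) -sum_nat_const.
apply: leq_sum => i _; have [ik|ki] := leqP i k.
  by apply: (up (k - i)%N); rewrite subnKC.
have := down (i - k)%N; rewrite subnKC; last exact: ltnW.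
by apply; rewrite -ltnS.
Qed.

(** * Elementary limits and the entropy bound for binomial coefficients *)

Section Limits.
Variable R : realType.

(** With [x = n + 1] after the shift, [ln (x + 1) <= 2 ln (2 sqrt x) <= 4 sqrt x], so the quotient
    is at most [4 / sqrt x]. *)
Lemma cvg_ln_div : ln n.+1%:R / n%:R @[n --> \oo] --> (0 : R).
Proof.
rewrite -cvg_shiftS /=.
have inv0 : n.+1%:R^-1 @[n --> \oo] --> (0 : R) by exact: cvg_harmonic.
have sqrt0 : 4 * Num.sqrt n.+1%:R^-1 @[n --> \oo] --> (0 : R).
  have <- : 4 * Num.sqrt 0 = 0 :> R by rewrite sqrtr0 mulr0.
  apply: cvgM; first exact: cvg_cst.
  by apply: continuous_cvg => //; exact: sqrt_continuous.
apply: (squeeze_cvgr _ (cvg_cst 0) sqrt0); near=> n.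
have n1 : 1 <= n.+1%:R :> R by rewrite ler1n.
rewrite divr_ge0 ?ln_ge0 ?ler1n//=.
rewrite ler_pdivrMr; last by lra.
set x : R := n.+1%:R in n1 *.
have s0 : 0 < Num.sqrt x by rewrite sqrtr_gt0; lra.
have xE : x = Num.sqrt x ^+ 2 by rewrite sqr_sqrtr//; lra.
have -> : 4 * Num.sqrt x^-1 * x = 4 * Num.sqrt x.
  rewrite sqrtrV; last by lra.
  by rewrite [X in _ * X = _]xE expr2 -mulrA mulKf// gt_eqF.
have : ln (n.+2%:R : R) <= ln ((2 * Num.sqrt x) ^+ 2).
  rewrite ler_ln ?posrE ?ltr0n ?exprn_gt0 ?mulr_gt0//.
  by rewrite exprMn -xE -natr1 -/x; lra.
rewrite lnXn ?mulr_gt0// => /le_trans; apply.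
have := @ln_sublinear R (2 * Num.sqrt x); rewrite mulr_gt0// => /(_ isT).
by rewrite mulr2n; lra.
Unshelve. all: by end_near. Qed.

Lemma cvg_div_infty (a : R) : a / n%:R @[n --> \oo] --> (0 : R).
Proof.
rewrite -cvg_shiftS.
have := cvgM (cvg_cst a) (@cvg_harmonic R); rewrite mulr0; exact.
Qed.

Lemma cvg_truncn (a : R) : 0 <= a ->
  (Num.truncn (a * n%:R))%:R / n%:R @[n --> \oo] --> a.
Proof.
move=> a0.
have low : a - 1 / n%:R @[n --> \oo] --> a.
  by have := cvgB (cvg_cst a) (cvg_div_infty 1); rewrite subr0; exact.
apply: (squeeze_cvgr _ low (cvg_cst a)); near=> n => /=.
have n0 : 0 < n%:R :> R by rewrite ltr0n; near: n; exact: nbhs_infty_gt.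
have /truncn_itv/andP[t1 t2] : 0 <= a * n%:R by rewrite mulr_ge0// ltW.
rewrite ler_pdivrMr// t1 andbT ler_pdivlMr// mulrBl divfK ?gt_eqF//.
by move: t2; rewrite -natr1; lra.
Unshelve. all: by end_near. Qed.

(** The logarithm of [modal_binomial_term], whose factor [M.+1] is negligible on the exponential
    scale. *)
Lemma ln_binomial_ge (M k r : nat) : (0 < r)%N -> (0 < k < M)%N ->
  M%:R * ent r (k%:R / M%:R) <= ln M.+1%:R + ln ('C(M, k) * r ^ k)%:R :> R.
Proof.
move=> r0 /andP[k0 kM].
have kR : 0 < k%:R :> R by rewrite ltr0n.
have MR : 0 < M%:R :> R by rewrite ltr0n; lia.
have MkR : 0 < (M - k)%:R :> R by rewrite ltr0n; lia.
have rR : 0 < r%:R :> R by rewrite ltr0n.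
have CR : 0 < 'C(M, k)%:R :> R by rewrite ltr0n bin_gt0 ltnW.
have := modal_binomial_term (ltnW kM).
rewrite -(ler_nat R) !natrM !natrX => H.
have {}H : ln (M%:R ^+ M) <=
    ln (M.+1%:R * ('C(M, k)%:R * ((M - k)%:R ^+ (M - k) * k%:R ^+ k))) :> R.
  by rewrite ler_ln// posrE ?mulr_gt0 ?exprn_gt0.
move: H; rewrite !lnM ?posrE ?mulr_gt0 ?exprn_gt0// !lnXn// => H.
rewrite /ent; have -> : 1 - k%:R / M%:R = (M - k)%:R / M%:R :> R.
  by rewrite natrB 1?ltnW// mulrBl divff// gt_eqF.
rewrite !ln_div ?posrE//.
move: H; rewrite -!(mulr_natl (ln _)).
set lM := ln M%:R; set lk := ln k%:R; set lMk := ln (M - k)%:R.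
set lr := ln r%:R; set lC := ln _; set l1 := ln _.
have -> : M%:R * (- (k%:R / M%:R) * (lk - lM) - (M - k)%:R / M%:R * (lMk - lM)
    + k%:R / M%:R * lr)
  = - k%:R * (lk - lM) - (M - k)%:R * (lMk - lM) + k%:R * lr.
  by field; rewrite gt_eqF.
by rewrite natrB 1?ltnW//; lra.
Qed.

Lemma continuous_ent r (u : R) : 0 < u < 1 -> {for u, continuous (ent r)}.
Proof.
move=> /andP[u0 u1].
apply: cvgD; last by apply: cvgM; [exact: cvg_id|exact: cvg_cst].
apply: cvgB.
  apply: cvgM; first by apply: cvgN; exact: cvg_id.
  exact: continuous_ln.
have cB : 1 - x @[x --> u] --> 1 - u.
  by apply: cvgB; [exact: cvg_cst|exact: cvg_id].
apply: cvgM => //.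
by apply: (continuous_cvg _ _ cB); apply: continuous_ln; rewrite subr_gt0.
Qed.


End Limits.

Lemma eq_near_cvg (R : realFieldType) (f g : nat -> R) (l : R) :
  f @ \oo --> l -> (\forall n \near \oo, f n = g n) -> g @ \oo --> l.
Proof.
move=> fl fg; apply: (squeeze_cvgr _ fl fl).
by apply: filterS fg => n ->; rewrite lexx.
Qed.

(** * Exponential rates of the two bounds along a sequence of cursors *)

Section Rates.
Variables (R : realType) (F : finGroupType) (r : nat).
Hypotheses (r0 : (0 < r)%N) (hF : #|F| = r.+1).

(** Excursions with overshoot [w n] sweep [M n] sites, about [(b + om) n], and have [k n], about
    [(1 - b - 2 om) n], letters left for the lamps. The strict inequalities keep the proportion of
    lit lamps inside [(0, 1)], where [ent] is shown to be continuous. *)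
Lemma sphere_rate_ge (j w : nat -> nat) (c : F) (b om e : R) :
  (forall n, (c != 1%g) || (w n == 0)) ->
  (j n)%:R / n%:R @[n --> \oo] --> b ->
  (w n)%:R / n%:R @[n --> \oo] --> om ->
  0 < 1 - b - 2 * om < b + om -> 0 < e ->
  \forall n \near \oo, (0 < sphere_count F (j n) n)%N /\
    (b + om) * ent r ((1 - b - 2 * om) / (b + om)) - e
      <= ln (sphere_count F (j n) n)%:R / n%:R.
Proof.
move=> cw jb wom; set mu := b + om; set ka := 1 - b - 2 * om.
move=> /andP[ka0 kamu] e0.
pose M n := (j n + w n)%N.
(* The number of swept lamps that makes the length exactly [n], the lamp at the turning point being
   counted apart. *)
pose k n := (n - (j n + (w n).*2 + (c != 1%g)))%N.
have Mmu : (M n)%:R / n%:R @[n --> \oo] --> mu.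
  apply: eq_near_cvg (cvgD jb wom) _; near=> n.
  by rewrite /M natrD mulrDl.
have k'ka : 1 - (j n)%:R / n%:R - 2 * ((w n)%:R / n%:R)
    - (c != 1%g)%:R / n%:R @[n --> \oo] --> ka.
  have -> : ka = ka - 0 by rewrite subr0.
  apply: cvgB; last exact: cvg_div_infty.
  apply: cvgB; last by apply: cvgM; [exact: cvg_cst|exact: wom].
  by apply: cvgB; [exact: cvg_cst|exact: jb].
have kE : \forall n \near \oo, (j n + (w n).*2 + (c != 1%g) < n)%N.
  near=> n.
  have n0 : 0 < n%:R :> R by rewrite ltr0n; near: n; exact: nbhs_infty_gt.
  have : 0 < 1 - (j n)%:R / n%:R - 2 * ((w n)%:R / n%:R)
      - (c != 1%g)%:R / n%:R :> R.
    by near: n; exact: (cvgr_gt _ k'ka).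
  rewrite -(pmulr_rgt0 _ n0) -(ltr_nat R) !natrD -mul2n natrM.
  have -> : n%:R * (1 - (j n)%:R / n%:R - 2 * ((w n)%:R / n%:R)
     - (c != 1%g)%:R / n%:R)
    = n%:R - (j n)%:R - 2 * (w n)%:R - (c != 1%g)%:R :> R.
    by field; rewrite gt_eqF.
  lra.
have kka : (k n)%:R / n%:R @[n --> \oo] --> ka.
  apply: eq_near_cvg k'ka _; near=> n.
  have n0 : 0 < n%:R :> R by rewrite ltr0n; near: n; exact: nbhs_infty_gt.
  have jn : (j n + (w n).*2 + (c != 1%g) < n)%N by near: n; exact: kE.
  rewrite /k natrB; last exact: ltnW.
  by rewrite !natrD -mul2n natrM; field; rewrite gt_eqF.
have mu0 : 0 < mu by lra.
have kM : \forall n \near \oo, (0 < k n < M n)%N.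
  near=> n.
  have n0 : 0 < n%:R :> R by rewrite ltr0n; near: n; exact: nbhs_infty_gt.
  rewrite -(ltr0n R) -(ltr_nat R) -(pmulr_lgt0 _ (_ : 0 < n%:R^-1)) ?invr_gt0//.
  rewrite -(ltr_pM2r (_ : 0 < n%:R^-1)) ?invr_gt0//.
  apply/andP; split; first by near: n; exact: (cvgr_gt _ kka).
  apply: (@lt_trans _ _ ((ka + mu) / 2)).
    by near: n; apply: (cvgr_lt _ kka); lra.
  by near: n; apply: (cvgr_gt _ Mmu); lra.
have kMcvg : (k n)%:R / (M n)%:R @[n --> \oo] --> ka / mu.
  apply: eq_near_cvg (cvgM kka (cvgV (lt0r_neq0 mu0) Mmu)) _; near=> n => /=.
  have n0 : 0 < n%:R :> R by rewrite ltr0n; near: n; exact: nbhs_infty_gt.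
  have /andP[? ?] : (0 < k n < M n)%N by near: n; exact: kM.
  have M0 : 0 < (M n)%:R :> R by rewrite ltr0n; lia.
  by field; rewrite !gt_eqF.
have low : (M n)%:R / n%:R * ent r ((k n)%:R / (M n)%:R) - ln n.+1%:R / n%:R
    @[n --> \oo] --> mu * ent r (ka / mu).
  have -> : mu * ent r (ka / mu) = mu * ent r (ka / mu) - 0 by rewrite subr0.
  apply: cvgB; last exact: cvg_ln_div.
  apply: cvgM => //; apply: continuous_cvg kMcvg; apply: continuous_ent.
  by rewrite divr_gt0//= ltr_pdivrMr// mul1r.
have low_e : \forall n \near \oo, mu * ent r (ka / mu) - e <
    (M n)%:R / n%:R * ent r ((k n)%:R / (M n)%:R) - ln n.+1%:R / n%:R.
  by apply: (cvgr_gt _ low); rewrite ltrBlDr ltrDl.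
near=> n.
have n0 : 0 < n%:R :> R by rewrite ltr0n; near: n; exact: nbhs_infty_gt.
have jn : (j n + (w n).*2 + (c != 1%g) < n)%N by near: n; exact: kE.
have /andP[k0 kMn] : (0 < k n < M n)%N by near: n; exact: kM.
have := @sphere_count_ge F (j n) (w n) (k n) c (cw n).
have -> : (j n + (w n).*2 + k n + (c != 1%g) = n)%N by rewrite /k; lia.
rewrite hF /= -/(M n) => /(_ (leq_ltn_trans (leq0n _) jn)) cnt.
have cnt0 : (0 < 'C(M n, k n) * r ^ k n)%N.
  by rewrite muln_gt0 bin_gt0 ltnW// expn_gt0 r0.
split; first exact: leq_trans cnt.
apply: (@le_trans _ _ ((M n)%:R / n%:R * ent r ((k n)%:R / (M n)%:R)
    - ln n.+1%:R / n%:R)).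
  by apply: ltW; near: n; exact: low_e.
rewrite mulrAC -mulrBl ler_pM2r ?invr_gt0// lerBlDl.
apply: le_trans (ln_binomial_ge R r0 (_ : (0 < k n < M n)%N)) _; first by rewrite k0.
apply: lerD; rewrite ler_ln ?posrE ?ltr0n ?ler_nat//.
- by rewrite ltnS /M; move: jn; rewrite -addnn; lia.
- exact: leq_trans cnt.
Unshelve. all: by end_near. Qed.

(** At slope [1] the rate is [0] and positivity suffices: walk straight to [j n], lighting
    [n - j n <= j n] lamps. *)
Lemma sphere_gt0 (j : nat -> nat) :
  (j n)%:R / n%:R @[n --> \oo] --> (1 : R) ->
  (\forall n \near \oo, (j n <= n)%N) ->
  \forall n \near \oo, (0 < sphere_count F (j n) n)%N.
Proof.
move=> j1 jn; near=> n.
have n0 : (0 < n)%N by near: n; exact: nbhs_infty_gt.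
have nR : 0 < n%:R :> R by rewrite ltr0n.
have jnn : (j n <= n)%N by near: n; exact: jn.
have nj : (n < (j n).*2)%N.
  have : 2^-1 < (j n)%:R / n%:R :> R.
    by near: n; apply: (cvgr_gt _ j1); lra.
  by rewrite ltr_pdivlMr// -(ltr_nat R) -mul2n natrM; lra.
have := @sphere_count_ge F (j n) 0 (n - j n) 1%g; rewrite eqxx orbT /= !addn0.
rewrite subnKC// => /(_ isT n0); apply: leq_trans.
by rewrite muln_gt0 bin_gt0 expn_gt0 hF r0 /= andbT; lia.
Unshelve. all: by end_near. Qed.

(** Logarithm of [ball_count_le] divided by [n]: the polynomial factor and the one extra factor [s]
    disappear in the limit. *)
Lemma ball_rate_le (j : nat -> nat) (b y e : R) :
  (j n)%:R / n%:R @[n --> \oo] --> b ->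
  (\forall n \near \oo, (j n <= n)%N) ->
  1 <= y -> 1 + r%:R / y <= y ^+ 2 -> 0 < e ->
  \forall n \near \oo, (0 < ball_count F (j n) n)%N ->
    ln (ball_count F (j n) n)%:R / n%:R <= growth r y b + e.
Proof.
move=> jb jn y1 ry e0; set s := 1 + r%:R / y.
have s1 : 1 <= s by rewrite lerDl divr_ge0//; lra.
have up : 2 * (ln n.+1%:R / n%:R) + ((j n)%:R / n%:R * ln s + ln s / n%:R)
    + (1 - (j n)%:R / n%:R) * ln y @[n --> \oo] --> growth r y b.
  have -> : growth r y b = 2 * 0 + (b * ln s + 0) + (1 - b) * ln y.
    by rewrite /growth -/s; ring.
  apply: cvgD; last first.
    by apply: cvgM; [apply: cvgB; [exact: cvg_cst|exact: jb]|exact: cvg_cst].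
  apply: cvgD; first by apply: cvgM; [exact: cvg_cst|exact: cvg_ln_div].
  apply: cvgD; last exact: cvg_div_infty.
  by apply: cvgM; [exact: jb|exact: cvg_cst].
have up_e : \forall n \near \oo, 2 * (ln n.+1%:R / n%:R) +
    ((j n)%:R / n%:R * ln s + ln s / n%:R) + (1 - (j n)%:R / n%:R) * ln y
    < growth r y b + e.
  by apply: (cvgr_lt _ up); rewrite ltrDl.
near=> n => N0.
have nR : 0 < n%:R :> R by rewrite ltr0n; near: n; exact: nbhs_infty_gt.
have jnn : (j n <= n)%N by near: n; exact: jn.
have Nle := @ball_count_le R F (j n) n y jnn y1; rewrite hF /= in Nle.
apply: (@le_trans _ _ (2 * (ln n.+1%:R / n%:R) +
    ((j n)%:R / n%:R * ln s + ln s / n%:R) + (1 - (j n)%:R / n%:R) * ln y)).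
  rewrite ler_pdivrMr//.
  have -> : (2 * (ln n.+1%:R / n%:R) + ((j n)%:R / n%:R * ln s + ln s / n%:R)
      + (1 - (j n)%:R / n%:R) * ln y) * n%:R
    = 2 * ln n.+1%:R + ((j n).+1%:R * ln s + (n%:R - (j n)%:R) * ln y).
    by rewrite -natr1; field; rewrite gt_eqF.
  have -> : 2 * ln n.+1%:R + ((j n).+1%:R * ln s + (n%:R - (j n)%:R) * ln y)
    = ln (n.+1%:R ^+ 2 * (s ^+ (j n).+1 * y ^+ (n - j n))).
    rewrite !lnM ?posrE ?mulr_gt0 ?exprn_gt0//; try lra.
    rewrite !lnXn//; try lra.
    by rewrite -natrB// !mulr_natl.
  rewrite ler_ln ?posrE ?ltr0n//; first exact: Nle.
  by rewrite !mulr_gt0 ?exprn_gt0//; lra.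
by apply: ltW; near: n; exact: up_e.
Unshelve. all: by end_near. Qed.

End Rates.

(** Since [lne] is infinite at [0], eventual positivity is what allows the passage to real
    logarithms. *)
Lemma log_rate_cvg (R : realType) (c : nat -> nat) (l : R) :
  (forall e, 0 < e -> \forall n \near \oo, (0 < c n)%N /\
    l - e <= ln (c n)%:R / n%:R <= l + e) ->
  log_rate R c @ \oo --> l%:E.
Proof.
move=> cl.
have cvgl : ln (c n)%:R / n%:R @[n --> \oo] --> l.
  apply/cvgrPdist_le => e /cl; apply: filterS => n [_ /andP[? ?]].
  by rewrite ler_distlC; apply/andP; split; lra.
have eqE : \forall n \near \oo, log_rate R c n = (ln (c n)%:R / n%:R)%:E.
  apply: filterS (cl 1 ltr01) => n [c0 _].
  by rewrite /log_rate lne_EFin ?ltr0n// -EFinM mulrC.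
apply: cvg_EFin; first by apply: filterS eqE => n ->.
by apply: eq_near_cvg cvgl _; apply: filterS eqE => n /= ->.
Qed.

(** * Matching the two bounds for nonnegative cursors *)

Section FiberRate.
Variables (R : realType) (F : finGroupType) (r : nat) (rho : R).
Hypotheses (r0 : (0 < r)%N) (hF : #|F| = r.+1) (hrho : is_rho r rho).
Variables (j : nat -> nat) (b : R).
Hypotheses (b01 : 0 <= b <= 1) (jb : (j n)%:R / n%:R @[n --> \oo] --> b).
Hypothesis jn : b = 1 -> \forall n \near \oo, (j n <= n)%N.

(** For [b < 1] the convergence forces this. At [b = 1] it would allow [j n > n], where the fibers
    are empty; there [jn] is used. *)
Lemma cursor_le_near : \forall n \near \oo, (j n <= n)%N.
Proof.
have [/jn//|b1] := eqVneq b 1.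
have lt1 : b < 1 by rewrite lt_neqAle b1; case/andP: b01.
near=> n.
have nR : 0 < n%:R :> R by rewrite ltr0n; near: n; exact: nbhs_infty_gt.
rewrite -(ler_nat R) -[leRHS]mul1r -ler_pdivrMr//; apply: ltW.
by near: n; exact: (cvgr_lt _ jb).
Unshelve. all: by end_near. Qed.

Lemma sphere_fiber_rate_ge (e : R) : 0 < e ->
  \forall n \near \oo, (0 < sphere_count F (j n) n)%N /\
    rate r rho b - e <= ln (sphere_count F (j n) n)%:R / n%:R.
Proof.
move=> e0; have /andP[b0 b1] := b01.
have /andP[c0 c1] := beta_crit_itv r0 hrho.
have /andP[u0 u1] := u_crit_itv r0 hrho.
have [bc|cb] := ltP b (beta_crit r rho).
  have [c cn1] : exists c : F, c != 1%g.
    have : (0 < #|predC1 (1%g : F)|)%N by rewrite cardC1 hF.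
    by move=> /card_gt0P[c]; rewrite inE; exists c.
  set u := u_crit r rho in u0 u1.
  have bu : b * (1 + u) < 1.
    by move: bc; rewrite /beta_crit -/u ltr_pdivlMr//; lra.
  (* The solution of [1 - b - 2 om = u (b + om)]: the proportion of lit lamps becomes the optimal
     [u_crit]. It is positive because [b < beta_crit = 1 / (1 + u)]. *)
  pose om := (1 - b * (1 + u)) / (2 + u).
  have om0 : 0 < om by rewrite divr_gt0//; lra.
  have omE : om * (2 + u) = 1 - b * (1 + u) by rewrite divfK// gt_eqF//; lra.
  have kaE : 1 - b - 2 * om = u * (b + om) by lra.
  have := @sphere_rate_ge R F r r0 hF j (fun n => Num.truncn (om * n%:R)) c b om e.
  rewrite kaE mulfK ?gt_eqF//; last by lra.
  rewrite rate_low ?(ltW bc)// (ent_u_crit r0 hrho).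
  have -> : (b + om) * ((2 + u) * ln rho) = (1 + b) * ln rho.
    by rewrite mulrA; congr (_ * _); lra.
  apply => //; first by rewrite cn1.
  - by apply: cvg_truncn; exact: ltW.
  - by apply/andP; split; nra.
rewrite (rate_high r0 hrho cb).
have [bE|bn1] := eqVneq b 1.
  apply: filterS (sphere_gt0 (R := R) r0 hF _ (jn bE)) => [n n0|]; last by move: jb; rewrite bE.
  split => //; rewrite bE subrr mul0r mul1r /ent subr0 ln1 oppr0 !mul0r mulr0.
  have : 0 <= ln (sphere_count F (j n) n)%:R / n%:R :> R.
    by rewrite divr_ge0// ln_ge0// ler1n.
  by lra.
have lt1 : b < 1 by rewrite lt_neqAle bn1.
(* Above [beta_crit] there is no overshoot and no turning lamp; a proportion [(1 - b) / b] of the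
   lamps is lit. *)
have := @sphere_rate_ge R F r r0 hF j (fun=> 0%N) 1%g b 0 e.
rewrite mulr0 subr0 addr0; apply => //.
- by move=> n; rewrite eqxx orbT.
- exact: cvg_div_infty.
- by apply/andP; split; lra.
Qed.

Lemma ball_fiber_rate_le (e : R) : 0 < e -> \forall n \near \oo,
  (0 < ball_count F (j n) n)%N ->
  ln (ball_count F (j n) n)%:R / n%:R <= rate r rho b + e.
Proof.
move=> e0; have e20 : 0 < e / 2 by rewrite divr_gt0.
have [y ry yb] := growth_approx r0 hrho b01 e20.
have y1 : 1 <= y by have [? _ _] := rho_facts r0 hrho; lra.
have := ball_rate_le hF jb cursor_le_near y1 (growth_sqr r0 hrho ry) e20.
by apply: filterS => n H /H /le_trans; apply; lra.
Qed.

(** Spheres lie in balls, so the lower bound for spheres and the upper bound for balls enclose both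
    counts. *)
Lemma fiber_rate_cvg :
  log_rate R (fun n => ball_count F (j n) n) @ \oo --> (rate r rho b)%:E /\
  log_rate R (fun n => sphere_count F (j n) n) @ \oo --> (rate r rho b)%:E.
Proof.
have sb n : (sphere_count F (j n) n <= ball_count F (j n) n)%N.
  exact: leq_subr.
have lnsb n : (0 < sphere_count F (j n) n)%N ->
    ln (sphere_count F (j n) n)%:R / n%:R <=
    ln (ball_count F (j n) n)%:R / n%:R :> R.
  move=> s0; rewrite ler_wpM2r ?invr_ge0// ler_ln ?posrE ?ltr0n ?ler_nat//.
  exact: leq_trans (sb n).
split; apply: log_rate_cvg => e e0; near=> n.
all: have [s0 low] : (0 < sphere_count F (j n) n)%N /\
    rate r rho b - e <= ln (sphere_count F (j n) n)%:R / n%:R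
  by near: n; exact: sphere_fiber_rate_ge.
all: have B0 : (0 < ball_count F (j n) n)%N by exact: leq_trans (sb n).
all: have up : ln (ball_count F (j n) n)%:R / n%:R <= rate r rho b + e
  by move: B0; near: n; exact: ball_fiber_rate_le.
- split => //; rewrite up andbT; exact: le_trans (lnsb n s0).
- split => //; rewrite low /=; exact: le_trans (lnsb n s0) up.
Unshelve. all: by end_near. Qed.

End FiberRate.

Theorem theorem1p2 (R : realType) (F : finGroupType) (r : nat)
    (hr : (0 < r)%N) (hF : #|F| = r.+1)
    (rho : R) (hrho : is_rho r rho) :
  exists I : R -> R,
    [/\ forall beta : R, -1 <= beta <= 1 ->
        forall j : nat -> int,
          ((j n)%:~R / n%:R : R) @[n --> \oo] --> beta ->
          (`|beta| = 1 -> \forall n \near \oo, `|j n| <= n%:Z) ->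
          log_rate R (fun n => ball_count F (j n) n) @ \oo --> (I beta)%:E /\
          log_rate R (fun n => sphere_count F (j n) n) @ \oo --> (I beta)%:E,
        forall beta : R, -1 <= beta <= 1 -> I (- beta) = I beta,
        concave_on `[0, 1] I /\ concave_on `[-1, 0] I
      & forall beta : R, -1 <= beta <= 1 ->
        (`|beta| <= beta_crit r rho -> I beta = (1 + `|beta|) * ln rho) /\
        (beta_crit r rho <= `|beta| ->
           I beta = `|beta| * ent r ((1 - `|beta|) / `|beta|))].
Proof.
exists (fun beta => rate r rho `|beta|); split.
- move=> beta hbeta j jbeta jn.
  have babs : 0 <= `|beta| <= 1 by rewrite normr_ge0 ler_norml.
  have -> : (fun n => ball_count F (j n) n) = (fun n => ball_count F `|j n|%N n).
    by apply/funext => n; rewrite ball_count_absz.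
  have -> : (fun n => sphere_count F (j n) n)
          = (fun n => sphere_count F `|j n|%N n).
    by apply/funext => n; rewrite sphere_count_absz.
  apply: (fiber_rate_cvg hr hF hrho (j := fun n => `|j n|%N)) => //.
    apply: eq_near_cvg (cvg_norm jbeta) _; apply: nearW => n /=.
    by rewrite normrM normfV (ger0_norm (ler0n R n)) natr_absz intr_norm.
- by move=> beta _; rewrite normrN.
(* On each half the absolute value is linear, so [rate_concave] applies, on [[-1, 0]] at the
   opposite points. *)
- split=> t x y; rewrite !inE/= !in_itv/= => /andP[x0 x1] /andP[y0 y1].
    have /andP[t0 t1] : 0 <= t%:num <= 1 by rewrite ge0 le1.
    suff H : - rate r rho `|t%:num * x + (1 - t%:num) * y|
      <= t%:num * - rate r rho `|x| + (1 - t%:num) * - rate r rho `|y| by exact: H.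
    rewrite !ger0_norm//; last by nra.
    have := @rate_concave R r rho hr hrho t%:num x y.
    by rewrite t0 t1 x0 x1 y0 y1 => /(_ isT isT isT); lra.
  have /andP[t0 t1] : 0 <= t%:num <= 1 by rewrite ge0 le1.
  suff H : - rate r rho `|t%:num * x + (1 - t%:num) * y|
    <= t%:num * - rate r rho `|x| + (1 - t%:num) * - rate r rho `|y| by exact: H.
  rewrite !ler0_norm//; last by nra.
  have := @rate_concave R r rho hr hrho t%:num (- x) (- y).
  rewrite t0 t1 !oppr_ge0 x1 y1 !(lerNl _ 1) x0 y0 => /(_ isT isT isT).
  have -> : t%:num * - x + (1 - t%:num) * - y = - (t%:num * x + (1 - t%:num) * y).
    by ring.
  by lra.
- move=> beta _; split; [exact: rate_low|exact: rate_high].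
Qed.
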